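(* Let $X\subseteq\mathbb{Z}^n$ be any digital image. For any $k\ge3$, the standard projection $\rho_k\colon S(X,k)\to X$ factors as $$\rho_k=\rho_{k-1}\circ\rho^c_k\colon S(X,k)\to S(X,k-1)\to X,$$ where $\rho_{k-1}\colon S(X,k-1)\to X$ is the standard projection and $\rho^c_k\colon S(X,k)\to S(X,k-1)$ is the partial projection map.
   Context: A digital image (of dimension $n$) is a finite subset $X\subseteq\mathbb{Z}^n$ with the adjacency relation: $x\sim_X y$ iff $|x_i-y_i|\le 1$ for every $i=1,\dots,n$. For $X\subseteq\mathbb{Z}^n$ a digital image and an integer $m\ge2$, the $m$-subdivision of $X$ is $S(X,m)=\{(y_1,\dots,y_n)\in\mathbb{Z}^n \mid (\lfloor y_1/m\rfloor,\dots,\lfloor y_n/m\rfloor)\in X\}$, and the standard projection is $\rho_m\colon S(X,m)\to X$, $\rho_m(y_1,\dots,y_n)=(\lfloor y_1/m\rfloor,\dots,\lfloor y_n/m\rfloor)$. For $x\in X$, $S(x,m)=\rho_m^{-1}(x)=\{(mx_1+r_1,\dots,mx_n+r_n)\mid 0\le r_i\le m-1\}$, so $S(X,m)$ is the disjoint union of the $S(x,m)$, $x\in X$, and $S(x,m)=S(x_1,m)\times\cdots\times S(x_n,m)$, where for $x\in\mathbb{Z}$, $S(x,m)=[mx,mx+m-1]$ (integer interval). Partial projection $\rho^c_k$ ($k\ge3$): for $x\in\mathbb{Z}$, define $\rho^c_k\colon S(x,k)\to S(x,k-1)$ by $\rho^c_k(kx+j)=(k-1)x+j$ for $0\le j\le\lfloor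 k/2\rfloor-1$ and $\rho^c_k(kx+j)=(k-1)x+j-1$ for $\lfloor k/2\rfloor\le j\le k-1$. For $x\in\mathbb{Z}^n$, define $\rho^c_k\colon S(x,k)\to S(x,k-1)$ as the coordinatewise product $\rho^c_k\times\cdots\times\rho^c_k$. For a digital image $X\subseteq\mathbb{Z}^n$, define $\rho^c_k\colon S(X,k)\to S(X,k-1)$ by assembling these over all $x\in X$. *)

(* Defs.v *)
From mathcomp Require Import all_boot all_order all_algebra.
From mathcomp Require Import zify.
From mathcomp Require Import boolp classical_sets cardinality.

Set Implicit Arguments.
Unset Strict Implicit.
Unset Printing Implicit Defensive.

Import Order.TTheory GRing.Theory Num.Theory.

Local Open Scope classical_set_scope.
Local Open Scope ring_scope.

Record digital_image (n : nat) := DigitalImage {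
  points :> set 'rV[int]_n;
  points_finite : finite_set points }.

(* The adjacency of a digital image is always the one inherited from Z^n; it
   is therefore determined by the set of points, not a field of the record. *)
Definition adjacent (n : nat) (X : digital_image n) : rel X :=
  fun x y => [forall i, `|\val x 0 i - \val y 0 i| <= 1].

(* For m > 0, (a %/ m)%Z is the floor of a / m, also for negative a. *)
Definition floor_div (n m : nat) (y : 'rV[int]_n) : 'rV[int]_n :=
  \row_i (y ord0 i %/ m)%Z.

Lemma subdivision_finite (n : nat) (X : digital_image n) (m : nat) :
  (2 <= m)%N -> finite_set [set y | points X (floor_div m y)].
Proof.
case: m => [//|m] _.
pose f (x : 'rV[int]_n) (r : {ffun 'I_n -> 'I_m.+1}) : 'rV[int]_n :=
  \row_i (x 0 i * m.+1%:Z + (r i)%:Z).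
have fin : finite_set [set f x r | x in points X & r in [set: {ffun 'I_n -> 'I_m.+1}]].
  by apply: finite_image2; [exact: points_finite | exact: finite_finset].
apply: sub_finite_set fin => y Xy /=.
exists (floor_div m.+1 y) => //.
exists [ffun i => inord `|(y ord0 i %% m.+1%:Z)%Z|%N] => //.
apply/rowP => i; rewrite !mxE ffunE inordK.
  by rewrite gez0_abs ?modz_ge0 // -divz_eq.
have := ltz_pmod (y 0 i) (isT : 0 < m.+1%:Z).
have := modz_ge0 (y 0 i) (isT : m.+1%:Z != 0).
lia.
Qed.

Definition subdivision (n : nat) (X : digital_image n) (m : nat)
    (hm : (2 <= m)%N) : digital_image n :=
  DigitalImage (subdivision_finite X hm).

Lemma std_proj_subproof (n : nat) (X : digital_image n) (m : nat)
  (hm : (2 <= m)%N) (y : subdivision X hm) : floor_div m (\val y) \in points X.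
Proof. by apply/mem_set; have /set_mem := valP y. Qed.

Definition std_proj (n : nat) (X : digital_image n) (m : nat)
    (hm : (2 <= m)%N) : subdivision X hm -> X :=
  fun y => exist _ (floor_div m (\val y)) (std_proj_subproof y).

Arguments std_proj {n} X {m} hm y.

(* An integer a lies in exactly one block S(x, k), with a = k x + j for
   x = floor (a / k) and j = a mod k, so the maps S(x, k) -> S(x, k - 1) are
   the restrictions of a single function on the integers. *)
Definition partial_coord (k : nat) (a : int) : int :=
  let x := (a %/ k)%Z in
  let j := (a %% k)%Z in
  if j <= (k %/ 2)%N%:Z - 1 then (k%:Z - 1) * x + j
  else (k%:Z - 1) * x + j - 1.

Lemma partial_coord_lo (k : nat) (x j : int) : (3 <= k)%N ->
  0 <= j <= (k %/ 2)%N%:Z - 1 ->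
  partial_coord k (k%:Z * x + j) = (k%:Z - 1) * x + j.
Proof.
move=> hk /andP[j0 jk]; rewrite /partial_coord.
have k0 : k%:Z != 0 by lia.
have hj : 0 <= j < `|k%:Z| by lia.
rewrite [k%:Z * x]mulrC divzMDl // modzMDl divz_small // modz_small; last by lia.
by rewrite addr0 jk.
Qed.

Lemma partial_coord_hi (k : nat) (x j : int) : (3 <= k)%N ->
  (k %/ 2)%N%:Z <= j <= k%:Z - 1 ->
  partial_coord k (k%:Z * x + j) = (k%:Z - 1) * x + j - 1.
Proof.
move=> hk /andP[j0 jk]; rewrite /partial_coord.
have k0 : k%:Z != 0 by lia.
have hj : 0 <= j < `|k%:Z| by lia.
rewrite [k%:Z * x]mulrC divzMDl // modzMDl divz_small // modz_small; last by lia.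
by rewrite addr0 ifF //; lia.
Qed.

Lemma partial_coord_block (k : nat) (x a : int) : (3 <= k)%N ->
  k%:Z * x <= a <= k%:Z * x + (k%:Z - 1) ->
  (k%:Z - 1) * x <= partial_coord k a <= (k%:Z - 1) * x + (k%:Z - 2).
Proof.
move=> hk; have [j ->] : exists j, a = k%:Z * x + j.
  by exists (a - k%:Z * x); rewrite addrC subrK.
move=> ha; have [lo|hi] := leP j ((k %/ 2)%N%:Z - 1).
  by rewrite partial_coord_lo //; lia.
by rewrite partial_coord_hi //; lia.
Qed.

Lemma ge3_ge2 (k : nat) : (3 <= k)%N -> (2 <= k)%N.
Proof. exact: ltnW. Qed.

Lemma ge3_pred_ge2 (k : nat) : (3 <= k)%N -> (2 <= k - 1)%N.
Proof. by lia. Qed.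

Lemma partial_proj_subproof (n : nat) (X : digital_image n) (k : nat)
    (hk : (3 <= k)%N) (y : subdivision X (ge3_ge2 hk)) :
  (\row_i partial_coord k (\val y 0 i))
    \in points (subdivision X (ge3_pred_ge2 hk)).
Proof.
apply/mem_set; have /set_mem /= := valP y.
congr (points X _); apply/rowP => i; rewrite !mxE.
set a := \val y 0 i; set x := (a %/ k)%Z.
have k0 : k%:Z != 0 by lia.
have kp : 0 < k%:Z by lia.
have ha : k%:Z * x <= a <= k%:Z * x + (k%:Z - 1).
  have := divz_eq a k; have := modz_ge0 a k0; have := ltz_pmod a kp.
  rewrite -/x; lia.
have hb := partial_coord_block hk ha.
set b := partial_coord k a in hb *.
have -> : b = x * (k - 1)%N%:Z + (b - (k%:Z - 1) * x) by lia.
by rewrite divzMDl ?divz_small ?addr0 //; lia.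
Qed.

Definition partial_proj (n : nat) (X : digital_image n) (k : nat)
    (hk : (3 <= k)%N) :
    subdivision X (ge3_ge2 hk) -> subdivision X (ge3_pred_ge2 hk) :=
  fun y => exist _ (\row_i partial_coord k (\val y 0 i))
                   (partial_proj_subproof y).

Arguments partial_proj {n} X {k} hk y.

(* Main.v *)
Require Import Defs.
From mathcomp Require Import all_boot.
From mathcomp Require Import all_order all_algebra zify boolp.

Import Order.TTheory GRing.Theory Num.Theory.

(** Everything happens in one coordinate.  The integers split into the blocks
    [kx, kx + k - 1], and the standard projection only records the index x of
    the block that contains a point.  The partial projection squeezes the block
    of index x for the length k into the block of index x for the length k - 1
    ([partial_coord_block]), so it preserves that index; dividing by k - 1
    afterwards therefore gives the same floor as dividing by k at once
    ([divz_partial_coord]).  Points of S(X, k) and of X are determined by their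
    coordinates, so this identity is the factorization. *)

Lemma divz_mem_block (m : nat) (x b : int) : (0 < m)%N ->
  (m%:Z * x <= b <= m%:Z * x + (m%:Z - 1))%R -> (b %/ m%:Z)%Z = x.
Proof.
move=> m0 hb.
have -> : b = (x * m%:Z + (b - m%:Z * x))%R by lia.
by rewrite divzMDl ?divz_small ?addr0 //; lia.
Qed.

Lemma mem_block_divz (m : nat) (a : int) : (0 < m)%N ->
  let x := (a %/ m%:Z)%Z in (m%:Z * x <= a <= m%:Z * x + (m%:Z - 1))%R.
Proof.
move=> m0 /=; have m_neq0 : (m%:Z != 0)%R by lia.
have m_gt0 : (0 < m%:Z)%R by lia.
have := divz_eq a m; have := modz_ge0 a m_neq0; have := ltz_pmod a m_gt0.
lia.
Qed.

(** The partial projection moves points only within matching blocks, and the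
    floor of a quotient is the index of a block. *)
Lemma divz_partial_coord (k : nat) (a : int) : (3 <= k)%N ->
  (partial_coord k a %/ (k - 1)%N%:Z)%Z = (a %/ k%:Z)%Z.
Proof.
move=> hk; apply: divz_mem_block; first by lia.
have k0 : (0 < k)%N by lia.
have := partial_coord_block hk (mem_block_divz k a k0); lia.
Qed.

Theorem corollary3p8 (n : nat) (X : digital_image n) (k : nat)
    (hk : (3 <= k)%N) :
  std_proj X (ge3_ge2 hk) =
    std_proj X (ge3_pred_ge2 hk) \o partial_proj X hk.
Proof.
apply/funext => y; apply: val_inj; apply/rowP => i.
by rewrite !mxE divz_partial_coord.
Qed.
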